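(* Let $(X_i)_{i\in\mathbb{N}}$ be a sequence of independent random variables with $P(X_i=1)=P(X_i=-1)=\frac12$, and let $F=\sum_{i=1}^\infty a_iX_i$ for $(a_i)_{i\in\mathbb{N}}\in\ell^2(\mathbb{N})$ such that $\mathbb{E}[F^2]=\sum_{i=1}^\infty a_i^2=1$. Let $N$ be a standard Gaussian random variable. Then $$d_K(F,N)\leq 2\sum_{i=1}^\infty |a_i|^3+\sup_{x\in\mathbb{R}}\,\sum_{k=1}^\infty a_k^2\cdot P\Big(x-|a_k|<\sum_{i\geq1,\ i\neq k} a_iX_i\leq x+|a_k|\Big).$$
   Context: The Kolmogorov distance is $d_K(F,N)=\sup_{x\in\mathbb{R}}|P(F\le x)-P(N\le x)|$. *)

(* Defs.v *)
From HB Require Import structures.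
From mathcomp Require Import all_boot all_order all_algebra.
From mathcomp Require Import all_classical all_reals all_analysis.

Set Implicit Arguments.
Unset Strict Implicit.
Unset Printing Implicit Defensive.

Import Order.TTheory GRing.Theory Num.Theory.
Import numFieldNormedType.Exports.

Local Open Scope classical_set_scope.
Local Open Scope ring_scope.
Local Open Scope ereal_scope.

(* Mutual independence of a sequence of real random variables: the product rule
   over every finite set of (pairwise distinct) indices. *)
Definition independent_RVs (R : realType) (d : measure_display)
    (T : measurableType d) (P : probability T R) (X : nat -> {RV P >-> R}) :=
  forall (J : seq nat) (A : nat -> set R), uniq J ->
    (forall i, i \in J -> measurable (A i)) ->
    P [set w | forall i, i \in J -> A i (X i w)] =
    \prod_(i <- J) P (X i @^-1` A i).

Definition rademacher (R : realType) (d : measure_display)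
    (T : measurableType d) (P : probability T R) (X : {RV P >-> R}) :=
  P (X @^-1` [set 1%R]) = (2^-1)%:E /\ P (X @^-1` [set (- 1)%R]) = (2^-1)%:E.

Definition standard_gaussian (R : realType) (d : measure_display)
    (T : measurableType d) (P : probability T R) (N : {RV P >-> R}) :=
  forall A : set R, measurable A ->
    distribution P N A = normal_prob (0 : R) (1 : R) A.

(* [L2_sum D Y S]: S is a version of the series of the Y i over the i satisfying
   D, whose partial sums converge to S in L^2(P); S is determined P-a.e. *)
Definition L2_sum (R : realType) (d : measure_display)
    (T : measurableType d) (P : probability T R)
    (D : pred nat) (Y : nat -> T -> R) (S : {RV P >-> R}) :=
  (fun n : nat =>
     'N[P]_2%:E[(fun w => (\sum_(0 <= i < n | D i) Y i w - S w)%:E)])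
    @ \oo --> 0.

(* The two random variables need not live on the same probability space. *)
Definition kolmogorov_distance (R : realType)
    (d : measure_display) (T : measurableType d) (P : probability T R)
    (d' : measure_display) (T' : measurableType d') (Q : probability T' R)
    (F : {RV P >-> R}) (N : {RV Q >-> R}) : \bar R :=
  ereal_sup (range (fun x : R => `|cdf F x - cdf N x|)).

(* Main.v *)
(** Stein's method. Let [g] be the bounded solution of Stein's equation
    [g' w - w g w = 1_(w <= x) - Phi x], so that
    [P (F <= x) - Phi x = E (g' F) - E (F g(F))]. As [F = G k + a k X k], where
    [X k] is a sign independent of [G k], the term [E (F g(F))] is the sum over
    [k] of [a k / 2 * E (g (G k + a k) - g (G k - a k))], and, since the
    [a k ^+ 2] add up to [1], the term [E (g' F)] is the sum over [k] of
    [a k ^+ 2 / 2 * E (g' (G k + a k) + g' (G k - a k))]. Their difference is, for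
    each [k], the error of the trapezoidal rule for [g'] on the interval of radius
    [`|a k|] around [G k]. The locally Lipschitz part [w g w] of [g'] contributes
    at most [2 * `|a k| ^+ 3]; its jump at [x] contributes only when [x] lies in
    that interval. *)
Require Import Defs.
From HB Require Import structures.
From mathcomp Require Import all_boot all_order all_algebra.
From mathcomp Require Import all_classical all_reals all_analysis.
From mathcomp Require Import measurable_realfun.
From mathcomp Require Import ring lra.

Set Implicit Arguments.
Unset Strict Implicit.
Unset Printing Implicit Defensive.

Import Order.TTheory GRing.Theory Num.Theory.
Import numFieldNormedType.Exports.

Local Open Scope classical_set_scope.
Local Open Scope ring_scope.

(** * The standard normal density and distribution function *)

(** The main obstacle is that [G k] is only an L2 limit, so that its independence from [X k] has to
    be earned. It is used in one form: each of the events [X k = 1] and [X k = -1] halves the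
    probability of every event that [G k] lies in a Borel set. This is exact for finite sums, but
    the limit keeps it only as an upper bound on the rays []-oo, x]]. The bounds for the two signs
    then add up to an equality, which extends to Borel sets and to bounded functions.

    The sums over [k] stay finite until the last limit, so that no infinite sum is exchanged with an
    expectation. *)

Lemma closed_MVT (R : realType) (f df : R -> R) (a b : R) : a <= b ->
  (forall z, a <= z <= b -> is_derive z 1 f (df z)) ->
  exists2 c, a <= c <= b & f b - f a = df c * (b - a).
Proof.
move=> ab dfab; have [||c] := @MVT_segment R f df a b ab.
- by move=> z zab; apply: dfab; rewrite !ltW ?(itvP zab).
- apply: derivable_within_continuous => z; rewrite in_itv/= => /dfab.
  by case.
by rewrite in_itv/=; exists c.
Qed.

Lemma is_derive1V (R : realType) (f : R -> R) (x df : R) : f x != 0 ->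
  is_derive x 1 f df -> is_derive x 1 (fun y => (f y)^-1) (- (df / f x ^+ 2)).
Proof.
move=> fx0 [dfx <-]; apply: DeriveDef; first exact: derivableV.
by rewrite deriveV// /GRing.scale/= mulNr mulrC.
Qed.

Section standard_normal.
Context {R : realType}.
Implicit Types w x y : R.

Definition gpdf w : R := normal_pdf 0 1 w.

Definition gcdf w : R := \int[lebesgue_measure]_(t in `]-oo, w]) gpdf t.

Lemma gpdfE w : gpdf w = normal_peak 1 * expR (- w ^+ 2 / 2).
Proof.
rewrite /gpdf normal_pdfE ?oner_eq0// /normal_fun subr0 expr1n.
by rewrite -[1 *+ 2]/(2%:R).
Qed.

Lemma gpdf_gt0 w : 0 < gpdf w.
Proof. by rewrite gpdfE mulr_gt0 ?expR_gt0// normal_peak_gt0// oner_eq0. Qed.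

Lemma is_derive_gpdf w : is_derive w 1 gpdf (- (w * gpdf w)).
Proof.
have -> : gpdf = (fun w => normal_peak 1 * expR (- w ^+ 2 / 2)).
  by apply/funext => v; rewrite gpdfE.
apply: is_derive_eq.
by rewrite /GRing.scale/=; field.
Qed.

(** Crude on purpose: [pi <= 4] makes the peak at least 1/4, and [expR (- 1 / 2) >= 1 - 1 / 2].
    Since p (1 - p) <= 1/4, the bound 1/8 is what yields the 2 of [stein_le2]. *)
Lemma gpdf_ge w : `|w| <= 1 -> 8^-1 <= gpdf w.
Proof.
move=> w1.
have w2 : w ^+ 2 <= 1 by rewrite -real_normK ?num_real// expr_le1.
rewrite gpdfE; have pi4 : pi <= 4 :> R by have := @pihalf_lt2 R; lra.
have s4 : Num.sqrt (1 ^+ 2 * pi *+ 2) <= 4 :> R.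
  rewrite (_ : 4 = Num.sqrt (4 ^+ 2)); last by rewrite sqrtr_sqr ger0_norm.
  by rewrite ler_sqrt//; lra.
have e2 : 2^-1 <= expR (- w ^+ 2 / 2).
  apply: le_trans (expR_ge1Dx _); lra.
have s0 : 0 < Num.sqrt (1 ^+ 2 * pi *+ 2) :> R.
  by rewrite sqrtr_gt0; have := @pi_gt0 R; lra.
have : 4^-1 <= normal_peak (1:R).
  by rewrite /normal_peak lef_pV2// posrE.
by move=> p4; rewrite (_ : 8^-1 = 4^-1 * 2^-1); [apply: ler_pM|field].
Qed.

Lemma integrable_gpdf (A : set R) : measurable A ->
  lebesgue_measure.-integrable A (EFin \o gpdf).
Proof. by move=> mA; apply: integrableS (integrable_normal_pdf _ _). Qed.

Lemma normal_prob_gcdf w : normal_prob 0 1 `]-oo, w] = (gcdf w)%:E.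
Proof.
rewrite /gcdf /Rintegral fineK//.
by apply: integrable_fin_num => //; exact: integrable_gpdf.
Qed.

Lemma is_derive_gcdf w : is_derive w 1 gcdf (gpdf w).
Proof.
have ww1 : w < w + 1 by rewrite ltrDl.
have cw : {for w, continuous gpdf}.
  by apply: continuous_normal_pdf; rewrite oner_eq0.
have wNy : (-oo%O < BRight w)%E by rewrite ltNyr.
have [] := continuous_FTC1 ww1 (integrable_gpdf (measurable_itv _)) wNy cw.
by move=> d1 d2; apply: DeriveDef => //; rewrite -derive1E.
Qed.


(** [gcdf] is the distribution function of the identity under the normal law; this view imports
    range, monotonicity and limits from the general theory of [cdf]. *)
Let idR : measurableTypeR R -> R := idfun.

#[local] HB.instance Definition _ :=
  @isMeasurableFun.Build _ _ _ _ idR (@measurable_id _ _ setT).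

Let idRV : {RV (normal_prob (0:R) (1:R)) >-> R} := idR.

Let cdf_idRV : cdf idRV = EFin \o gcdf.
Proof. by apply/funext => w /=; rewrite -normal_prob_gcdf. Qed.

Lemma gcdf_ge0 w : 0 <= gcdf w.
Proof. by have := cdf_ge0 idRV w; rewrite cdf_idRV/= lee_fin. Qed.

Lemma gcdf_le1 w : gcdf w <= 1.
Proof. by have := cdf_le1 idRV w; rewrite cdf_idRV/= lee_fin. Qed.

Lemma gcdf_nondecreasing : {homo gcdf : x y / x <= y}.
Proof.
move=> x y xy; rewrite -lee_fin.
by have := cdf_nondecreasing idRV xy; rewrite cdf_idRV.
Qed.

Lemma cvg_gcdfy : gcdf w @[w --> +oo] --> (1 : R).
Proof. by have := cvg_cdfy1 idRV; rewrite cdf_idRV => /fine_cvg. Qed.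

Lemma cvg_gcdfNy : gcdf w @[w --> -oo] --> (0 : R).
Proof. by have := cvg_cdfNy0 idRV; rewrite cdf_idRV => /fine_cvg. Qed.

(* Decreasing on each half-line; comparing it with the limits of [gcdf] at both
   infinities gives the two Mills inequalities below. *)
Let mills w := gcdf w + gpdf w / w.

Let is_derive_mills w : w != 0 -> is_derive w 1 mills (- (gpdf w / w ^+ 2)).
Proof.
move=> w0; have dgc := is_derive_gcdf w; have dgp := is_derive_gpdf w.
have dV := is_derive1V w0 (is_derive_id w 1).
apply: is_derive_eq; rewrite /GRing.scale/=.
by field.
Qed.

Let mills_noninc x y : x <= y -> (0 < x) || (y < 0) -> mills y <= mills x.
Proof.
move=> xy xy0; rewrite -subr_le0.
have [z /andP[xz zy]|c _ ->] :=
  @closed_MVT _ mills (fun w => - (gpdf w / w ^+ 2)) _ _ xy.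
  apply: is_derive_mills; move: xy0 => /orP[x0|y0].
    by rewrite gt_eqF// (lt_le_trans x0).
  by rewrite lt_eqF// (le_lt_trans zy).
rewrite mulNr oppr_le0 mulr_ge0 ?subr_ge0//.
by rewrite divr_ge0 ?sqr_ge0// ltW// gpdf_gt0.
Qed.

(** For [0 < w] this says [1 <= mills w]. Otherwise the limit of [gcdf] gives some [y >= w] with
    [mills w < gcdf y], whereas [gcdf y <= mills y <= mills w]. *)
Lemma mulr_gcdfC_le w : 0 <= w -> w * (1 - gcdf w) <= gpdf w.
Proof.
rewrite le_eqVlt => /predU1P[<-|w0]; first by rewrite mul0r ltW// gpdf_gt0.
rewrite mulrC -ler_pdivlMr// lerBlDl leNgt; apply/negP => lt1.
have [y [wy]] : exists y, w <= y /\ mills w < gcdf y.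
  near (+oo%R : set_system R) => y; exists y; split.
    by near: y; apply: nbhs_pinfty_ge; rewrite num_real.
  by near: y; exact: (cvgr_gt _ cvg_gcdfy).
rewrite ltNge => /negP; apply.
apply: le_trans (mills_noninc wy _); last by rewrite w0.
by rewrite lerDl divr_ge0 ?(ltW (gpdf_gt0 _))// (le_trans (ltW w0)).
Unshelve. all: by end_near. Qed.

Lemma mulNr_gcdf_le w : w <= 0 -> - w * gcdf w <= gpdf w.
Proof.
rewrite le_eqVlt => /predU1P[->|w0].
  by rewrite oppr0 mul0r ltW// gpdf_gt0.
rewrite mulrC -ler_pdivlMr ?oppr_gt0// invrN mulrN -subr_le0 opprK.
rewrite leNgt; apply/negP => lt0.
have [y [yw]] : exists y, y <= w /\ gcdf y < mills w.
  near (-oo%R : set_system R) => y; exists y; split.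
    by near: y; apply: nbhs_ninfty_le; rewrite num_real.
  by near: y; exact: (cvgr_lt _ cvg_gcdfNy).
rewrite ltNge => /negP; apply.
apply: (le_trans (mills_noninc yw _)); first by rewrite w0 orbT.
rewrite gerDl mulr_ge0_le0 ?(ltW (gpdf_gt0 _))// invr_le0.
by rewrite (le_trans yw)// ltW.
Unshelve. all: by end_near. Qed.

End standard_normal.

(** * Stein's equation *)

(** Each one-sided difference quotient of [f] is that of a branch, because both branches take the
    value [f x] at [x] itself. *)
Lemma is_derive_glue (R : realType) (f f1 f2 : R -> R) (x df : R) :
  (forall w, w <= x -> f w = f1 w) -> (forall w, x <= w -> f w = f2 w) ->
  is_derive x 1 f1 df -> is_derive x 1 f2 df -> is_derive x 1 f df.
Proof.
move=> ff1 ff2 [d1 e1] [d2 e2].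
suff dq : h^-1 *: ((f \o shift x) (h *: 1) - f x) @[h --> 0^'] --> df.
  by apply: DeriveDef; [apply/cvg_ex; exists df | apply: cvg_lim].
apply: (@cvg_at_right_left_dnbhs _ R^o).
- have : h^-1 *: ((f2 \o shift x) (h *: 1) - f2 x) @[h --> 0^'] --> df.
    by rewrite -e2; exact: d2.
  move=> /cvg_dnbhs_at_right; apply: cvg_trans; apply: near_eq_cvg; near=> h.
  have h0 : 0 < h by near: h; exact: nbhs_right_gt.
  by rewrite /= !ff2// /GRing.scale/= mulr1 lerDr ltW.
- have : h^-1 *: ((f1 \o shift x) (h *: 1) - f1 x) @[h --> 0^'] --> df.
    by rewrite -e1; exact: d1.
  move=> /cvg_dnbhs_at_left; apply: cvg_trans; apply: near_eq_cvg; near=> h.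
  have h0 : h < 0 by near: h; exact: nbhs_left_lt.
  by rewrite /= !ff1// /GRing.scale/= mulr1 gerDr ltW.
Unshelve. all: by end_near. Qed.

(** The bound [K * b ^+ 2] is the integral of [2 * K * (b - t)] over [[0, b]]. Only [u] is confined
    to the interval in the Lipschitz hypothesis, to match [mul_stein_lipschitz], whose constant
    depends on its first argument alone. *)
Lemma trapezoid_le (R : realType) (H h : R -> R) (w b K : R) : 0 <= b ->
  (forall z : R, is_derive z 1 H (h z)) ->
  (forall u v : R, w - b <= u <= w + b -> `|h u - h v| <= K * `|u - v|) ->
  `|b * (h (w + b) + h (w - b)) - (H (w + b) - H (w - b))| <= K * b ^+ 2.
Proof.
move=> b0 dH hK; set c := h (w + b) + h (w - b).
(* [h] is only Lipschitz, hence no Taylor expansion: instead, [psi K] is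
   nondecreasing and [psi (- K)] nonincreasing on [0, b]. *)
pose psi s t := H (w + t) - H (w - t) - t * c + s * (2 * b * t - t ^+ 2).
have dpsi (s t : R) :
    is_derive t 1 (psi s) (h (w + t) + h (w - t) - c + s * (2 * (b - t))).
  have dp : is_derive t 1 (fun t => H (w + t)) (h (w + t)).
    have := dH (w + t) => dHw; apply: is_derive_eq (is_derive1_comp _ _) _.
    by rewrite add0r /GRing.scale/= mulr1.
  have dm : is_derive t 1 (fun t => H (w - t)) (- h (w - t)).
    have := dH (w - t) => dHw; apply: is_derive_eq (is_derive1_comp _ _) _.
    by rewrite add0r /GRing.scale/= mul1r mulrN1.
  by rewrite /psi; apply: is_derive_eq; rewrite /GRing.scale/=; ring.
have psib s : psi s b - psi s 0 = H (w + b) - H (w - b) - b * c + s * b ^+ 2.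
  by rewrite /psi addr0 subr0; ring.
have hc t : 0 <= t <= b -> `|h (w + t) + h (w - t) - c| <= K * (2 * (b - t)).
  move=> /andP[t0 tb].
  have e1 : `|w + b - (w + t)| = b - t.
    by rewrite (_ : _ - _ = b - t) ?ger0_norm ?subr_ge0//; ring.
  have e2 : `|w - b - (w - t)| = b - t.
    by rewrite (_ : _ - _ = - (b - t)) ?normrN ?ger0_norm ?subr_ge0//; ring.
  have m1 : w - b <= w + b <= w + b by lra.
  have m2 : w - b <= w - b <= w + b by lra.
  have := hK _ (w + t) m1; have := hK _ (w - t) m2.
  by rewrite e1 e2 !ler_norml /c; lra.
rewrite ler_norml; apply/andP; split.
- have [t tb] := closed_MVT b0 (fun t _ => dpsi (- K) t).
  rewrite psib subr0 => e; have := hc _ tb; rewrite ler_norml => /andP[_ u].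
  have : (h (w + t) + h (w - t) - c + - K * (2 * (b - t))) * b <= 0.
    by rewrite mulr_le0_ge0//; lra.
  by rewrite -e; lra.
- have [t tb] := closed_MVT b0 (fun t _ => dpsi K t).
  rewrite psib subr0 => e; have := hc _ tb; rewrite ler_norml => /andP[u _].
  have : 0 <= (h (w + t) + h (w - t) - c + K * (2 * (b - t))) * b.
    by rewrite mulr_ge0//; lra.
  by rewrite -e; lra.
Qed.

Section stein_solution.
Context {R : realType} (x : R).
Implicit Types w u v b : R.

(** The two usual branches, below and above [x], in one formula: sign and size can be read off
    without splitting cases. *)
Definition stein w := gcdf (Num.min w x) * (1 - gcdf (Num.max w x)) / gpdf w.

(* The derivative of [stein] away from the kink [x], where the value is the one
   for which Stein's equation still holds. *)
Definition dstein w := w * stein w + (w <= x)%R%:R - gcdf x.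

Let steinL w := gcdf w * (1 - gcdf x) / gpdf w.

Let steinR w := gcdf x * (1 - gcdf w) / gpdf w.

Let stein_left w : w <= x -> stein w = steinL w.
Proof. by move=> wx; rewrite /stein min_l// max_r. Qed.

Let stein_right w : x <= w -> stein w = steinR w.
Proof. by move=> xw; rewrite /stein min_r// max_l. Qed.

Lemma stein_ge0 w : 0 <= stein w.
Proof.
by rewrite divr_ge0 ?(ltW (gpdf_gt0 _))// mulr_ge0 ?gcdf_ge0// subr_ge0 gcdf_le1.
Qed.

(** The right-hand side is the value at [w] of the solution with parameter [x = w], the largest over
    all parameters. *)
Lemma stein_le w : stein w <= gcdf w * (1 - gcdf w) / gpdf w.
Proof.
rewrite ler_pM2r ?invr_gt0 ?gpdf_gt0// ler_pM ?gcdf_ge0 ?subr_ge0 ?gcdf_le1//.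
  by rewrite gcdf_nondecreasing// ge_min lexx.
by rewrite lerB// gcdf_nondecreasing// le_max lexx.
Qed.

Lemma normr_mul_stein_le1 w : `|w * stein w| <= 1.
Proof.
rewrite normrM (ger0_norm (stein_ge0 w)).
apply: (@le_trans _ _ (`|w| * (gcdf w * (1 - gcdf w) / gpdf w))).
  by rewrite ler_wpM2l// stein_le.
have := gcdf_ge0 w; have := gcdf_le1 w; rewrite mulrA ler_pdivrMr ?gpdf_gt0// mul1r.
have [w0|w0] := leP 0 w.
  move=> c1 c0; apply: le_trans (mulr_gcdfC_le w0).
  by rewrite ger0_norm// mulrCA ler_piMl// mulr_ge0// subr_ge0.
move=> c1 c0; apply: le_trans (mulNr_gcdf_le (ltW w0)).
rewrite ltr0_norm// mulrA ler_piMr//; last by rewrite gerBl.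
by rewrite mulr_ge0// oppr_ge0 ltW.
Qed.

(** Outside the unit interval the bound on [w * stein w] is enough; inside, p (1 - p) <= 1/4 is
    divided by a density of at least 1/8. *)
Lemma stein_le2 w : stein w <= 2.
Proof.
have [w1|w1] := leP 1 `|w|.
  have := normr_mul_stein_le1 w; rewrite normrM (ger0_norm (stein_ge0 w)).
  apply: contraTT; rewrite -!ltNge => s2.
  have : `|w| * stein w >= 1 * stein w by rewrite ler_wpM2r// stein_ge0.
  lra.
apply: le_trans (stein_le _) _; rewrite ler_pdivrMr ?gpdf_gt0//.
have := gpdf_ge (ltW w1); have := sqr_ge0 (gcdf w - 2^-1); nra.
Qed.

Let is_derive_gpdfV w : is_derive w 1 (fun y => (gpdf y)^-1) (w / gpdf w).
Proof.
have g0 : gpdf w != 0 by rewrite gt_eqF ?gpdf_gt0.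
by apply: is_derive_eq (is_derive1V g0 (is_derive_gpdf w)) _; field.
Qed.

Let is_derive_steinL w : is_derive w 1 steinL (w * steinL w + (1 - gcdf x)).
Proof.
have := is_derive_gpdfV w; have := is_derive_gcdf w => dc dV.
have g0 : gpdf w != 0 by rewrite gt_eqF ?gpdf_gt0.
by apply: is_derive_eq; rewrite /steinL /GRing.scale/=; field.
Qed.

Let is_derive_steinR w : is_derive w 1 steinR (w * steinR w - gcdf x).
Proof.
have := is_derive_gpdfV w; have := is_derive_gcdf w => dc dV.
have g0 : gpdf w != 0 by rewrite gt_eqF ?gpdf_gt0.
by apply: is_derive_eq; rewrite /steinR /GRing.scale/=; field.
Qed.

(** Write c for [gcdf w] and p for [gpdf w]. If [w < 0], Mills puts p + w c between 0 and p. If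
    [0 <= w], replace [1 - gcdf x] by the larger 1 - c: then (1 - c) (p + w c) = (1 - c) p + c w (1
    - c), at most p by Mills. The right branch is the mirror image. *)
Let dsteinL_bound w : w <= x -> `|w * steinL w + (1 - gcdf x)| <= 1.
Proof.
move=> wx; have p0 := gpdf_gt0 w.
have [c0 c1] := (gcdf_ge0 w, gcdf_le1 w).
have [C0 C1] := (gcdf_ge0 x, gcdf_le1 x).
have cC : gcdf w <= gcdf x by exact: gcdf_nondecreasing.
rewrite (_ : w * steinL w + (1 - gcdf x) =
    (1 - gcdf x) * (gpdf w + w * gcdf w) / gpdf w); last first.
  by rewrite /steinL; field; rewrite gt_eqF.
rewrite normrM normfV (gtr0_norm p0) ler_pdivrMr// mul1r ler_norml.
have [w0|w0] := leP 0 w.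
  have m := mulr_gcdfC_le w0.
  apply/andP; split.
    apply: (@le_trans _ _ 0); first lra.
    by rewrite mulr_ge0 ?subr_ge0// addr_ge0 ?mulr_ge0// ltW.
  apply: (@le_trans _ _ ((1 - gcdf w) * (gpdf w + w * gcdf w))).
    rewrite ler_wpM2r//; last by rewrite lerB.
    by rewrite addr_ge0 ?mulr_ge0// ltW.
  have : gcdf w * (w * (1 - gcdf w)) <= gcdf w * gpdf w by rewrite ler_wpM2l.
  lra.
have m := mulNr_gcdf_le (ltW w0).
have wg : w * gcdf w <= 0 by rewrite mulr_le0_ge0// ltW.
nra.
Qed.

Let dsteinR_bound w : x <= w -> `|w * steinR w - gcdf x| <= 1.
Proof.
move=> xw; have p0 := gpdf_gt0 w.
have [c0 c1] := (gcdf_ge0 w, gcdf_le1 w).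
have [C0 C1] := (gcdf_ge0 x, gcdf_le1 x).
have cC : gcdf x <= gcdf w by exact: gcdf_nondecreasing.
rewrite (_ : w * steinR w - gcdf x =
    - (gcdf x * (gpdf w - w * (1 - gcdf w)) / gpdf w)); last first.
  by rewrite /steinR; field; rewrite gt_eqF.
rewrite normrN normrM normfV (gtr0_norm p0) ler_pdivrMr// mul1r ler_norml.
have [w0|w0] := leP w 0.
  have m := mulNr_gcdf_le w0.
  have wg : w * (1 - gcdf w) <= 0 by rewrite mulr_le0_ge0// subr_ge0.
  apply/andP; split.
    apply: (@le_trans _ _ 0); first lra.
    by rewrite mulr_ge0// subr_ge0 (le_trans wg)// ltW.
  apply: (@le_trans _ _ (gcdf w * (gpdf w - w * (1 - gcdf w)))).
    by rewrite ler_wpM2r// subr_ge0 (le_trans wg)// ltW.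
  have : (1 - gcdf w) * (- w * gcdf w) <= (1 - gcdf w) * gpdf w.
    by rewrite ler_wpM2l// subr_ge0.
  lra.
have m := mulr_gcdfC_le (ltW w0).
have wg : 0 <= w * (1 - gcdf w) by rewrite mulr_ge0 ?subr_ge0// ltW.
nra.
Qed.

Let lipschitz_of_derive (f df : R -> R) u v : u <= v ->
  (forall z, u <= z <= v -> is_derive z 1 f (df z)) ->
  (forall z, u <= z <= v -> `|df z| <= 1) -> `|f v - f u| <= v - u.
Proof.
move=> uv dff df1; have [z zuv ->] := closed_MVT uv dff.
by rewrite normrM (@ger0_norm _ (v - u)) ?subr_ge0// ler_piMl ?df1 ?subr_ge0.
Qed.

(** [stein] has a kink at [x], so the mean value theorem is applied on each side of it and the two
    estimates are added. *)
Lemma stein_lipschitz u v : `|stein u - stein v| <= `|u - v|.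
Proof.
wlog uv : u v / u <= v.
  move=> H; have [|/ltW] := leP u v; first exact: H.
  by move=> /H; rewrite distrC [leRHS]distrC.
rewrite distrC [leRHS]distrC [leRHS]ger0_norm ?subr_ge0//.
have L (a b : R) : a <= b -> b <= x -> `|stein b - stein a| <= b - a.
  move=> ab bx; rewrite !stein_left// ?(le_trans ab)//.
  apply: lipschitz_of_derive ab _ _ => z /andP[az zb].
    exact: is_derive_steinL.
  by apply: dsteinL_bound; exact: le_trans bx.
have Rt (a b : R) : a <= b -> x <= a -> `|stein b - stein a| <= b - a.
  move=> ab xa; rewrite !stein_right// ?(le_trans xa)//.
  apply: lipschitz_of_derive ab _ _ => z /andP[az zb].
    exact: is_derive_steinR.
  by apply: dsteinR_bound; exact: le_trans xa _.
have [vx|xv] := leP v x; first exact: L.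
have [ux|xu] := leP u x; last exact: Rt (ltW _).
have := L _ _ ux (lexx _); have := Rt _ _ (ltW xv) (lexx _).
rewrite !ler_norml; lra.
Qed.

(** The summand [|u|] comes from the Lipschitz constant 1 of [stein], the summand 2 from its upper
    bound. *)
Lemma mul_stein_lipschitz u v :
  `|u * stein u - v * stein v| <= (`|u| + 2) * `|u - v|.
Proof.
rewrite (_ : _ - _ = u * (stein u - stein v) + (u - v) * stein v); last by ring.
apply: le_trans (ler_normD _ _) _; rewrite [leRHS]mulrDl lerD//.
  by rewrite normrM ler_wpM2l// stein_lipschitz.
by rewrite normrM (ger0_norm (stein_ge0 v)) mulrC ler_wpM2r// stein_le2.
Qed.

(* The affine correction makes the two branches match to first order at [x], so
   that this is an antiderivative of [w * stein w] on the whole line. *)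
Definition stein_smooth w := stein w - Num.min w x + gcdf x * w.

Lemma is_derive_stein_smooth w : is_derive w 1 stein_smooth (w * stein w).
Proof.
pose f1 w := steinL w - w + gcdf x * w.
pose f2 w := steinR w - x + gcdf x * w.
have d1 (z : R) : is_derive z 1 f1 (z * steinL z).
  have := is_derive_steinL z => dL.
  by apply: is_derive_eq; rewrite /GRing.scale/=; ring.
have d2 (z : R) : is_derive z 1 f2 (z * steinR z).
  have := is_derive_steinR z => dL.
  by apply: is_derive_eq; rewrite /GRing.scale/=; ring.
have e1 z : z <= x -> stein_smooth z = f1 z.
  by move=> zx; rewrite /stein_smooth stein_left// min_l.
have e2 z : x <= z -> stein_smooth z = f2 z.
  by move=> zx; rewrite /stein_smooth stein_right// min_r.
have [wx|xw|->] := ltgtP w x.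
- rewrite stein_left ?(ltW wx)//; have [dw <-] := d1 w.
  have nf : \near w, f1 w = stein_smooth w.
    by near=> z; rewrite e1// ltW//; near: z; exact: lt_nbhsl.
  apply: DeriveDef; first exact: near_eq_derivable nf dw.
  by apply/esym/near_eq_derive.
- rewrite stein_right ?(ltW xw)//; have [dw <-] := d2 w.
  have nf : \near w, f2 w = stein_smooth w.
    by near=> z; rewrite e2// ltW//; near: z; exact: lt_nbhsr.
  apply: DeriveDef; first exact: near_eq_derivable nf dw.
  by apply/esym/near_eq_derive.
- apply: (is_derive_glue e1 e2); first by rewrite stein_left//.
  by rewrite stein_right.
Unshelve. all: by end_near. Qed.

Lemma stein_difference_le w b : 0 <= b ->
  `|b * (dstein (w + b) + dstein (w - b)) - (stein (w + b) - stein (w - b))|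
    <= b ^+ 2 * (`|w| + b + 2) + b * (x - b < w <= x + b)%R%:R.
Proof.
move=> b0.
have /= := @trapezoid_le R stein_smooth (fun z => z * stein z) w b
  (`|w| + b + 2) b0 is_derive_stein_smooth.
move=> /(_ _)/wrap[u v /andP[uw wu]|].
  apply: le_trans (mul_stein_lipschitz _ _) _; rewrite ler_wpM2r// lerD2r.
  rewrite -(subrK w u) addrC (le_trans (ler_normD _ _))// lerD2l.
  by rewrite ler_norml; lra.
(* Separates the smooth part, ready for the trapezoidal rule, from the step function and its
   antiderivative [Num.min _ x]; the terms in [gcdf x] cancel. *)
have -> : b * (dstein (w + b) + dstein (w - b)) - (stein (w + b) - stein (w - b))
  = b * ((w + b) * stein (w + b) + (w - b) * stein (w - b)) -
    (stein_smooth (w + b) - stein_smooth (w - b)) +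
    (b * ((w + b <= x)%R%:R + (w - b <= x)%R%:R) -
     (Num.min (w + b) x - Num.min (w - b) x)).
  by rewrite /dstein /stein_smooth; ring.
move=> T; apply: le_trans (ler_normD _ _) _; rewrite lerD//.
  by rewrite [leRHS]mulrC.
(* The step part equals [w - x] when [w - b <= x < w + b] and vanishes otherwise. The convention
   [w <= x] at the jump is what makes the window open on the left and closed on the right. *)
have [xw|wx] := ltP x (w + b); have [xw'|wx'] := ltP x (w - b); rewrite /= ?mulr0n ?mulr1n.
- rewrite (_ : w <= x + b = false); last by apply/negbTE; rewrite -ltNge; lra.
  by rewrite andbF ?mulr0n ?mulr1n ler_norml; lra.
- have -> : x - b < w by lra.
  have -> : w <= x + b by lra.
  by rewrite /= ?mulr0n ?mulr1n ler_norml; lra.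
- by lra.
- rewrite (_ : x - b < w = false); last by apply/negbTE; rewrite -leNgt; lra.
  by rewrite /= ?mulr0n ?mulr1n ler_norml; lra.
Qed.

Lemma measurable_stein : measurable_fun setT stein.
Proof.
apply: continuous_measurable_fun => w; apply/cvgrPdist_le => e e0; near=> y.
apply: le_trans (stein_lipschitz _ _) _; near: y.
by apply: cvgr_dist_le => //; exact: cvg_id.
Unshelve. all: by end_near. Qed.

Lemma measurable_dstein : measurable_fun setT dstein.
Proof.
apply: measurable_funB => //; apply: measurable_funD.
  by apply: measurable_funM => //; exact: measurable_stein.
rewrite (_ : (fun w => _) = \1_(`]-oo, x] : set R)); first exact: measurable_indic.
by apply/funext => w; rewrite indicE mem_setE in_itv.
Qed.

Lemma normr_dstein_le2 w : `|dstein w| <= 2.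
Proof.
have := normr_mul_stein_le1 w; have := gcdf_ge0 x; have := gcdf_le1 x.
by rewrite /dstein; case: (w <= x); rewrite !ler_norml/=; lra.
Qed.

End stein_solution.

(** * Finite Rademacher sums *)

(** Hoelder's inequality against the constant 1, whose L2 norm under a probability is 1. *)
Lemma L2_sum_cvg_L1 (R : realType) d (T : measurableType d)
    (P : probability T R) (D : pred nat) (Y : nat -> T -> R) (S : {RV P >-> R}) :
  (forall i, measurable_fun setT (Y i)) -> L2_sum D Y S ->
  (\int[P]_w `|(\sum_(0 <= i < n | D i) Y i w - S w)%:E| @[n --> \oo] --> 0)%E.
Proof.
move=> mY; rewrite /L2_sum; apply: squeeze_cvge; last exact: cvg_cst.
apply: nearW => n; apply/andP; split; first exact: integral_ge0.
set f := (fun w => \sum_(0 <= i < n | D i) Y i w - S w).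
have mf : measurable_fun setT f.
  apply: measurable_funB => //.
  under eq_fun do rewrite -big_filter.
  exact: measurable_sum.
have h2 : (2^-1 + 2^-1 = 1 :> R) by field.
have := @hoelder _ _ _ P f (cst 1) 2 2 mf (measurable_cst _) _ _ h2.
rewrite Lnorm_cst1 [X in (_ * X)%E](_ : _ = 1%E); last first.
  by rewrite -[RHS](poweR1r (2^-1)); congr poweR; exact: probability_setT.
rewrite mule1 Lnorm1.
by under eq_integral do rewrite /= mulr1; apply.
Qed.

Section rademacher_sequence.
Context {R : realType} d {T : measurableType d} {P : probability T R}.
Context (X : nat -> {RV P >-> R}).
Context (X_indep : independent_RVs X) (X_rademacher : forall i, rademacher (X i)).
Implicit Types (L J : seq nat) (e : nat -> R).

(** Prescribes the signs with index in [L]. Integrating over such events lets an induction fix the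
    signs one at a time. *)
Definition sign_event L e : set T := [set w | forall i, i \in L -> X i w = e i].

Lemma sign_event_nil e : sign_event [::] e = setT.
Proof. by apply/seteqP; split. Qed.

Lemma sign_event_cons i L e :
  sign_event (i :: L) e = X i @^-1` [set e i] `&` sign_event L e.
Proof.
apply/seteqP; split => w.
  move=> h; split; first by apply: h; rewrite mem_head.
  by move=> j jL; apply: h; rewrite in_cons jL orbT.
by move=> [h1 h2] j; rewrite in_cons => /predU1P[->|/h2].
Qed.

Lemma measurable_sign_event L e : measurable (sign_event L e).
Proof.
elim: L => [|i L IH]; first by rewrite sign_event_nil.
by rewrite sign_event_cons; exact: measurableI.
Qed.

Lemma probability_sign_event L e : uniq L ->
  (forall i, i \in L -> e i = 1 \/ e i = -1) ->
  P (sign_event L e) = ((2^-1) ^+ size L)%:E.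
Proof.
move=> uL eL; have := X_indep uL (A := fun i => [set e i]).
rewrite -/(sign_event L e) => -> //.
elim: L eL {uL} => [|i L IH] eL; first by rewrite big_nil.
rewrite big_cons IH; last by move=> j jL; apply: eL; rewrite in_cons jL orbT.
rewrite exprS EFinM; congr (_ * _)%E.
by have [->|->] := eL i (mem_head _ _); case: (X_rademacher i).
Qed.

(** [rademacher] gives the mass of two values only; the event [N] that another value is taken has
    probability 0 and is discarded. *)
Lemma ge0_integral_sign_split (i : nat) (E : set T) (f : T -> \bar R) :
  measurable E -> measurable_fun setT f -> (forall w, 0 <= f w)%E ->
  (\int[P]_(w in E) f w = \int[P]_(w in X i @^-1` [set 1%R] `&` E) f w +
                          \int[P]_(w in X i @^-1` [set (-1)%R] `&` E) f w)%E.
Proof.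
move=> mE mf f0.
have mX r : measurable (X i @^-1` [set r]).
  by rewrite -[X in measurable X]setTI; exact: measurable_funP.
have dX : [disjoint X i @^-1` [set 1] & X i @^-1` [set (-1 : R)]].
  by apply/disj_setPS => w [/= -> h]; lra.
pose N := ~` (X i @^-1` [set 1] `|` X i @^-1` [set (- 1)]).
have PN : P N = 0%E.
  rewrite probability_setC; last exact: measurableU.
  rewrite measureU//; last exact/disj_set2P.
  transitivity (1 - ((2^-1)%:E + (2^-1)%:E) : \bar R)%E.
    have [p1 p2] := X_rademacher i.
    by congr (_ - (_ + _))%E; [exact: p1|exact: p2].
  by rewrite -EFinD; congr EFin; lra.
rewrite (@ge0_negligible_integral _ _ _ _ E N)//; last first.
- exact: measurable_funTS.
- by apply: measurableC; exact: measurableU.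
rewrite (_ : E `\` N = (X i @^-1` [set 1] `&` E) `|` (X i @^-1` [set (- 1)] `&` E)).
  rewrite ge0_integral_setU//; first exact: measurableI.
  - exact: measurableI.
  - exact: measurable_funTS.
  - apply/disj_setPS => w [[w1 _] [w2 _]].
    by move/disj_setPS : dX; apply; split; [exact: w1|exact: w2].
by rewrite /N setDE setCK setIUr setIC (setIC E).
Qed.

Context (a : nat -> R).

Fixpoint rademacher_mean (f : R -> R) J (c : R) : R :=
  if J is i :: J' then
    (rademacher_mean f J' (c + a i) + rademacher_mean f J' (c - a i)) / 2
  else f c.

Definition rademacher_sum J w : R := \sum_(i <- J) a i * X i w.

Lemma measurable_rademacher_sum J : measurable_fun setT (rademacher_sum J).
Proof. by apply: measurable_sum => i; exact: measurable_funM. Qed.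

(** Allowing a sign event on [L] makes the induction go through: splitting on the sign of the head
    of [J] moves that index to [L] and shifts [c]. Independence enters only through the probability
    of the final sign event. *)
Lemma rademacher_meanE (f : R -> R) J L e c : uniq (J ++ L) ->
  measurable_fun setT f -> (forall y, 0 <= f y) ->
  (forall i, i \in L -> e i = 1 \/ e i = -1) ->
  (\int[P]_(w in sign_event L e) (f (c + rademacher_sum J w))%:E =
   ((2^-1) ^+ size L * rademacher_mean f J c)%:E)%E.
Proof.
move=> + mf f0; elim: J L e c => [|j J IH] L e c uJL eL.
  rewrite (eq_integral (cst (f c)%:E)); last first.
    by move=> w _; rewrite /rademacher_sum big_nil addr0.
  rewrite integral_cst; last exact: measurable_sign_event.
  by rewrite [X in (_ * X)%E](probability_sign_event _ eL)// -EFinM mulrC.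
move: uJL; rewrite /= mem_cat negb_or => /andP[/andP[jJ jL] uJL].
have mfS K c' : measurable_fun setT (fun w => (f (c' + rademacher_sum K w))%:E).
  apply/measurable_EFinP; apply: measurableT_comp => //.
  by apply: measurable_funD => //; exact: measurable_rademacher_sum.
rewrite (@ge0_integral_sign_split j)//; last 2 first.
- exact: measurable_sign_event.
- by move=> w; rewrite lee_fin.
have step s : s = 1 \/ s = -1 ->
    (\int[P]_(w in X j @^-1` [set s] `&` sign_event L e)
       (f (c + rademacher_sum (j :: J) w))%:E =
     ((2^-1) ^+ (size L).+1 * rademacher_mean f J (c + s * a j))%:E)%E.
  move=> s1; pose e' i := if i == j then s else e i.
  have eL' i : i \in L -> e' i = e i.
    by move=> iL; rewrite /e'; case: eqP => // ij; rewrite -ij iL in jL.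
  have -> : X j @^-1` [set s] `&` sign_event L e = sign_event (j :: L) e'.
    rewrite sign_event_cons {1}/e' eqxx; congr (_ `&` _).
    by apply/seteqP; split => w h i iL; [rewrite eL' ?h|rewrite -eL' ?h].
  rewrite -(IH (j :: L) e'); last 2 first.
  - by rewrite uniq_catC /= mem_cat negb_or jL jJ uniq_catC.
  - move=> i; rewrite in_cons => /predU1P[->|iL]; first by rewrite /e' eqxx.
    by rewrite eL'//; exact: eL.
  apply: eq_integral => w; rewrite inE => /(_ j (mem_head _ _)).
  rewrite /e' eqxx /rademacher_sum big_cons => ->.
  by rewrite addrA (mulrC s).
rewrite !step; [|by right|by left].
rewrite -EFinD; congr EFin.
by rewrite mul1r mulN1r exprS; field.
Qed.


(** [rademacher_meanE] with [L = [:: k]] and with [L = [::]] gives the same mean, and the powers of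
    1/2 differ by one factor. *)
Lemma rademacher_sum_half k J s (B : set R) : uniq (k :: J) ->
  s = 1 \/ s = -1 -> measurable B ->
  (P (X k @^-1` [set s] `&` rademacher_sum J @^-1` B) =
   (2^-1)%:E * P (rademacher_sum J @^-1` B))%E.
Proof.
move=> /= /andP[kJ uJ] s1 mB.
have mS : measurable (rademacher_sum J @^-1` B).
  by rewrite -[X in measurable X]setTI; exact: measurable_rademacher_sum.
have prob L e : uniq (J ++ L) -> (forall i, i \in L -> e i = 1 \/ e i = -1) ->
    (P (sign_event L e `&` rademacher_sum J @^-1` B) =
     ((2^-1) ^+ size L * rademacher_mean \1_B J 0)%:E)%E.
  move=> uJL eL; rewrite -(@rademacher_meanE _ J L e)//.
  under eq_integral do rewrite add0r.
  rewrite setIC -integral_indic//; exact: measurable_sign_event.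
have := prob [::] (fun=> s).
rewrite cats0 sign_event_nil setTI mul1r => /(_ uJ) -> //.
have := prob [:: k] (fun=> s); rewrite cats1 rcons_uniq kJ uJ => /(_ isT).
rewrite sign_event_cons sign_event_nil setIT => -> //.
Qed.

(** No covariance is computed: the cross terms cancel in ((c + a)^2 + (c - a)^2) / 2 = c^2 + a^2 at
    each step of the recursion. *)
Lemma integral_rademacher_sum_sqr J : uniq J ->
  (\int[P]_w ((rademacher_sum J w) ^+ 2)%:E = (\sum_(i <- J) a i ^+ 2)%:E)%E.
Proof.
move=> uJ; have mean c : rademacher_mean (fun y => y ^+ 2) J c =
    c ^+ 2 + \sum_(i <- J) a i ^+ 2.
  elim: J c {uJ} => [|i J IH] c /=; first by rewrite big_nil addr0.
  by rewrite !IH big_cons; field.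
have := @rademacher_meanE (fun y => y ^+ 2) J [::] (fun=> 1) 0.
rewrite cats0 sign_event_nil mean expr0 mul1r expr0n/= add0r => <- //.
- by under [in RHS]eq_integral do rewrite add0r.
- by move=> y; exact: sqr_ge0.
Qed.

End rademacher_sequence.

(** * Independence of a sign and an L1 limit *)

Section half_independence.
Context {R : realType} d {T : measurableType d} {P : probability T R}.
Implicit Types (A B E : set T).

Let p E : R := fine (P E).

Let pK E : measurable E -> P E = (p E)%:E.
Proof. by move=> mE; rewrite fineK// fin_num_measure. Qed.

Let p_le A B : measurable A -> measurable B -> A `<=` B -> p A <= p B.
Proof. by move=> mA mB AB; rewrite -lee_fin -!pK// le_measure ?inE. Qed.

Let p_U2 A B : measurable A -> measurable B -> p (A `|` B) <= p A + p B.
Proof.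
move=> mA mB; rewrite -lee_fin EFinD -!pK//; last exact: measurableU.
exact: measureU2.
Qed.

(** Replacing [G] by [S n] and then [S n] by [G] moves the threshold to the right each time; right
    continuity of [cdf G] absorbs the two moves. Only an upper bound survives. *)
Lemma half_of_L1_limit (A : set T) (S : nat -> T -> R) (G : {RV P >-> R}) :
  measurable A -> (forall n, measurable_fun setT (S n)) ->
  (\int[P]_w `|(S n w - G w)%:E| @[n --> \oo] --> 0)%E ->
  (forall n (B : set R), measurable B ->
    P (A `&` S n @^-1` B) = (2^-1)%:E * P (S n @^-1` B))%E ->
  forall x : R, (P (A `&` G @^-1` `]-oo, x]) <= (2^-1)%:E * cdf G x)%E.
Proof.
move=> mA mS SG0 half x.
have mG (B : set R) : measurable B -> measurable (G @^-1` B).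
  by move=> mB; rewrite -[X in measurable X]setTI; exact: measurable_funP.
have mSB n (B : set R) : measurable B -> measurable (S n @^-1` B).
  by move=> mB; rewrite -[X in measurable X]setTI; exact: mS.
have cdfE y : cdf G y = (p (G @^-1` `]-oo, y]))%:E.
  by rewrite -pK//; exact: mG.
apply/lee_addgt0Pr => e e0.
have [y xy qy] : exists2 y, x < y & (cdf G y < cdf G x + e%:E)%E.
  have cx : (cdf G x < cdf G x + e%:E)%E.
    by rewrite cdfE -EFinD lte_fin ltrDl.
  have nx := cdf_right_continuous (X := G) (x := x) (open_ereal_lt' cx).
  near x^'+ => y; exists y; first by near: y; exact: nbhs_right_gt.
  by near: y; exact: nx.
(* Half of the gap for each of the two replacements. *)
pose dl := (y - x) / 2.
have dl0 : 0 < dl by rewrite divr_gt0// subr_gt0.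
pose N n := [set w | (dl%:E <= `|(S n w - G w)%:E|)%E].
have mSG n : measurable_fun setT (fun w => (S n w - G w)%:E).
  by apply/measurable_EFinP; apply: measurable_funB.
have mN n : measurable (N n).
  rewrite -[N n]setTI; apply: emeasurable_fun_c_infty => //.
  exact: measurableT_comp.
(* The errors add up to [e]: e/2 from the choice of [y], e/3 from the first replacement, and e/6
   from the second, which is halved. *)
have [n Nn] : exists n, p (N n) <= e / 3.
  have ed : (0 < (dl * (e / 3))%:E :> \bar R)%E.
    by rewrite lte_fin mulr_gt0// divr_gt0.
  near \oo => n; exists n.
  have lt : (\int[P]_w `|(S n w - G w)%:E| < (dl * (e / 3))%:E)%E.
    by near: n; exact: SG0 (open_ereal_lt' ed).
  (* Markov's inequality. *)
  have := @le_integral_comp_abse _ _ _ P setT measurableT _ dl id.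
  move=> /(_ (fun w => (S n w - G w)%:E)).
  move=> /(_ (@measurable_id _ _ setT) (fun _ h => h) (fun _ _ _ _ h => h) (mSG n) dl0).
  rewrite setTI -/(N n) => le.
  have := le_lt_trans le lt.
  by rewrite [X in (_ * X)%E](pK (mN n)) -EFinM lte_fin ltr_pM2l// => /ltW.
have mA1 : measurable (A `&` G @^-1` `]-oo, x]).
  by apply: measurableI => //; exact: mG.
have mSx : measurable (S n @^-1` `]-oo, x + dl]) by exact: mSB.
have mA2 : measurable (A `&` S n @^-1` `]-oo, x + dl]) by exact: measurableI.
have s1 : p (A `&` G @^-1` `]-oo, x]) <=
    p (A `&` S n @^-1` `]-oo, x + dl]) + p (N n).
  apply: le_trans (p_U2 mA2 (mN n)); apply: p_le => //; first exact: measurableU.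
  move=> w [Aw]; rewrite /preimage/= !in_itv/= => Gx.
  have [Nw|] := leP dl `|S n w - G w|; first by right; rewrite /N/= lee_fin.
  by rewrite ltr_norml => /andP[_ ?]; left; split => //=; rewrite ?in_itv/=; lra.
have s2 : p (S n @^-1` `]-oo, x + dl]) <= p (G @^-1` `]-oo, y]) + p (N n).
  apply: le_trans (p_U2 _ (mN n)); last exact: mG.
  apply: p_le => //; first by apply: measurableU => //; exact: mG.
  move=> w; rewrite /preimage/= !in_itv/= => Sx.
  have [Nw|] := leP dl `|S n w - G w|; first by right; rewrite /N/= lee_fin.
  rewrite ltr_norml => /andP[? _]; left; rewrite /= ?in_itv/=.
  have : x + dl + dl = y by rewrite /dl; field.
  by lra.
have s3 : p (A `&` S n @^-1` `]-oo, x + dl]) = 2^-1 * p (S n @^-1` `]-oo, x + dl]).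
  by rewrite {1}/p half// (pK mSx).
move: qy; rewrite pK// !cdfE -EFinM -!EFinD !(lte_fin, lee_fin) => qy.
lra.
Unshelve. all: by end_near. Qed.

(* Convergence in L1 gives no equality at the atoms of [G], but the two
   inequalities add up to an equality, so that both are equalities. *)
Lemma half_of_cdf (A1 A2 : set T) (G : {RV P >-> R}) :
  measurable A1 -> measurable A2 ->
  P A1 = (2^-1)%:E ->
  (forall E, measurable E -> P E = P (A1 `&` E) + P (A2 `&` E))%E ->
  (forall x, P (A1 `&` G @^-1` `]-oo, x]) <= (2^-1)%:E * cdf G x)%E ->
  (forall x, P (A2 `&` G @^-1` `]-oo, x]) <= (2^-1)%:E * cdf G x)%E ->
  forall B : set R, measurable B ->
    (P (A1 `&` G @^-1` B) = (2^-1)%:E * P (G @^-1` B))%E.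
Proof.
move=> mA1 mA2 PA1 split12 le1 le2.
have mG (B : set R) : measurable B -> measurable (G @^-1` B).
  by move=> mB; rewrite -[X in measurable X]setTI; exact: measurable_funP.
have ray x : (P (A1 `&` G @^-1` `]-oo, x]) = (2^-1)%:E * P (G @^-1` `]-oo, x]))%E.
  have := split12 _ (mG _ (measurable_itv `]-oo, x])).
  move: (le1 x) (le2 x); rewrite /cdf /distribution /pushforward.
  have m1 : measurable (A1 `&` G @^-1` `]-oo, x]).
    by apply: measurableI => //; exact: mG.
  have m2 : measurable (A2 `&` G @^-1` `]-oo, x]).
    by apply: measurableI => //; exact: mG.
  have m3 : measurable (G @^-1` `]-oo, x]) by exact: mG.
  rewrite (pK m1) (pK m2) (pK m3) -!EFinM -EFinD !lee_fin => h1 h2 [h3].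
  by congr EFin; lra.
(* The complement keeps the factor 1/2 because [A1] itself has probability 1/2. *)
have ray' x : (P (A1 `&` G @^-1` `]x, +oo[) = (2^-1)%:E * P (G @^-1` `]x, +oo[))%E.
  have mN := mG _ (measurable_itv `]-oo, x]).
  have mA1N : measurable (A1 `&` G @^-1` `]-oo, x]) by exact: measurableI.
  have GC : G @^-1` `]x, +oo[ = ~` (G @^-1` `]-oo, x]).
    by rewrite preimage_setC setCitvl.
  rewrite GC probability_setC// -setDE measureD//; last first.
    by rewrite -ge0_fin_numE// fin_num_measure.
  rewrite [X in (X - _)%E]PA1 [X in (_ - X)%E]ray.
  by rewrite (pK mN) -!EFinM -!EFinB; congr EFin; field.
have h0 : 0 <= 2^-1 :> R by rewrite invr_ge0.
pose h : {nonneg R} := NngNum h0.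
move=> B mB.
(* Both sides are finite measures in [B] that agree on the open right rays, a generating family
   stable under intersection. *)
suff : pushforward (mrestr P mA1) G B = mscale h (distribution P G) B.
  by rewrite /pushforward /mrestr /mscale/= setIC.
apply: (measure_unique (@RGenOInfty.G R) (fun k => `](- k%:R), +oo[%classic)
  (RGenOInfty.measurableE R)); last exact: mB.
- move=> _ _ [x ->] [y ->]; exists (Num.max x y); apply/seteqP; split => w /=.
    by rewrite !in_itv/= !andbT gt_max => -[-> ->].
  by rewrite !in_itv/= !andbT gt_max => /andP.
- by move=> k; exists (- k%:R).
- rewrite -subTset => w _; exists (Num.truncn `|w|).+1 => //=.
  rewrite in_itv/= andbT ltrNl (le_lt_trans _ (truncnS_gt _))//.
  by rewrite -normrN ler_norm.
- by move=> _ [x ->]; rewrite /= /pushforward /mrestr /mscale/= setIC ray'.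
- move=> k; rewrite /= /pushforward /mrestr/=.
  apply: le_lt_trans (probability_le1 P _) (ltry _).
  by apply: measurableI => //; exact: mG.
Qed.

(** The hypothesis on [B] equates two measures on the line, hence the integrals of nonnegative
    functions. It is applied to [f + M], and [P A = 1/2] removes the constant again. *)
Lemma Rintegral_half (A : set T) (G : {RV P >-> R}) (f : R -> R) M :
  measurable A -> P A = (2^-1)%:E ->
  (forall B : set R, measurable B ->
    P (A `&` G @^-1` B) = (2^-1)%:E * P (G @^-1` B))%E ->
  measurable_fun setT f -> (forall y, `|f y| <= M) ->
  \int[P]_(w in A) f (G w) = 2^-1 * \int[P]_w f (G w).
Proof.
move=> mA PA half mf fM.
have h0 : 0 <= 2^-1 :> R by rewrite invr_ge0.
pose h : {nonneg R} := NngNum h0.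
have mG (B : set R) : measurable B -> measurable (G @^-1` B).
  by move=> mB; rewrite -[X in measurable X]setTI; exact: measurable_funP.
have ge0 (g : R -> \bar R) : measurable_fun setT g -> (forall y, 0 <= g y)%E ->
    (\int[P]_(w in A) g (G w) = (2^-1)%:E * \int[P]_w g (G w))%E.
  move=> mg g0.
  have mgG : measurable_fun setT (g \o G) by exact: measurableT_comp.
  transitivity (\int[mrestr P mA]_(w in A) g (G w))%E.
    by apply: eq_measure_integral => E mE EA; rewrite /= /mrestr setIidl.
  transitivity (\int[mrestr P mA]_w g (G w))%E.
    rewrite [RHS](@ge0_negligible_integral _ _ _ _ _ (~` A))//.
    - by rewrite setTD setCK.
    - exact: measurableC.
    - by rewrite /= /mrestr setICl measure0.
  transitivity (\int[pushforward (mrestr P mA) G]_y g y)%E.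
    by rewrite ge0_integral_pushforward.
  transitivity (\int[mscale h (distribution P G)]_y g y)%E.
    apply: eq_measure_integral => B mB _.
    by rewrite /= /pushforward /mrestr /mscale/= setIC; exact: half.
  by rewrite ge0_integral_mscale// ge0_integral_distribution.
have ifG : P.-integrable setT (EFin \o (f \o G)).
  apply: measurable_bounded_integrable => //.
  - by rewrite (le_lt_trans (probability_le1 _ _))// ltry.
  - exact: measurableT_comp.
  - exists M; split; first exact: num_real.
    by move=> M' MM' w _ /=; rewrite (le_trans (fM _))// ltW.
have iM E : measurable E -> P.-integrable E (EFin \o cst M).
  by move=> mE; exact: finite_measure_integrable_cst.
have fM0 y : (0 <= (f y + M)%:E)%E.
  by rewrite lee_fin -lerBlDr sub0r; have := fM y; rewrite ler_norml => /andP[].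
have := ge0 (fun y => (f y + M)%:E) _ fM0.
move=> /(_ _)/wrap[|/(congr1 fine)].
  by apply/measurable_EFinP; exact: measurable_funD.
have ifGM : P.-integrable setT (fun w => (f (G w) + M)%:E).
  have := integrableD measurableT ifG (iM _ measurableT).
  by apply: eq_integrable.
rewrite fineM//; last exact: integrable_fin_num.
rewrite -!/(Rintegral _ _ _) RintegralD//; last 2 first.
- exact: integrableS ifG.
- exact: iM.
rewrite RintegralD//; last exact: iM.
rewrite !Rintegral_cst// [fine (_ A)](congr1 fine PA).
rewrite [fine (_ setT)](congr1 fine (@probability_setT _ _ _ P))/=; lra.
Qed.

End half_independence.

(** * Rademacher series *)

Lemma bounded_integrable (R : realType) d (T : measurableType d)
    (P : probability T R) (f : T -> R) (M : R) :
  measurable_fun setT f -> (forall w, `|f w| <= M) ->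
  P.-integrable setT (EFin \o f).
Proof.
move=> mf fM; apply: measurable_bounded_integrable => //.
  by rewrite (le_lt_trans (probability_le1 _ _))// ltry.
exists M; split; first exact: num_real.
by move=> M' MM' w _ /=; rewrite (le_trans (fM _))// ltW.
Qed.

Section rademacher_series.
Context {R : realType} d {T : measurableType d} {P : probability T R}.
Context (X : nat -> {RV P >-> R}) (a : nat -> R).
Context (F : {RV P >-> R}) (G : nat -> {RV P >-> R}).
Context (X_indep : independent_RVs X) (X_rademacher : forall i, rademacher (X i)).
Context (a_norm1 : (\sum_(0 <= i <oo) ((a i) ^+ 2)%:E = 1)%E).
Context (F_sum : L2_sum xpredT (fun i w => (a i * X i w)%R) F).
Context (G_sum : forall k : nat,
  L2_sum [pred i : nat | i != k] (fun i w => (a i * X i w)%R) (G k)).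

Let rest (k n : nat) : seq nat := [seq i <- index_iota 0 n | i != k].

Let rest_uniq k n : uniq (rest k n).
Proof. by rewrite filter_uniq// iota_uniq. Qed.

Let measurable_term i : measurable_fun setT (fun w => a i * X i w).
Proof. exact: measurable_funM. Qed.

Lemma sum_sqr_le1 n : \sum_(0 <= i < n) a i ^+ 2 <= 1.
Proof.
rewrite -lee_fin -sumEFin -a_norm1; apply: nneseries_lim_ge => i _ _.
by rewrite lee_fin sqr_ge0.
Qed.

Lemma cvg_sum_sqr : \sum_(0 <= i < n) a i ^+ 2 @[n --> \oo] --> (1 : R).
Proof.
have c : (\sum_(0 <= i < n) ((a i) ^+ 2)%:E @[n --> \oo] --> 1%:E)%E.
  rewrite -[1%:E]/(1%E) -a_norm1.
  have : cvgn (fun n => \sum_(0 <= i < n) (a i ^+ 2)%:E)%E.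
    by apply: is_cvg_ereal_nneg_natsum => i _; rewrite lee_fin sqr_ge0.
  exact.
rewrite (_ : (fun n => _) = fine \o (fun n => \sum_(0 <= i < n) (a i ^+ 2)%:E)%E).
  exact: fine_cvg c.
by apply/funext => n /=; rewrite sumEFin.
Qed.

Lemma normr_coef_le1 k : `|a k| <= 1.
Proof.
rewrite -(@expr_le1 _ 2)// real_normK ?num_real//.
apply: le_trans (sum_sqr_le1 k.+1); rewrite big_nat_recr//= lerDr.
by apply: sumr_ge0 => i _; exact: sqr_ge0.
Qed.

Lemma cvg_series_L1 :
  (\int[P]_w `|(rademacher_sum X a (index_iota 0 n) w - F w)%:E| @[n --> \oo] --> 0)%E.
Proof. exact: L2_sum_cvg_L1 F_sum. Qed.

Lemma cvg_rest_L1 k :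
  (\int[P]_w `|(rademacher_sum X a (rest k n) w - G k w)%:E| @[n --> \oo] --> 0)%E.
Proof.
have := L2_sum_cvg_L1 measurable_term (G_sum k).
apply: cvg_trans; apply: near_eq_cvg; apply: nearW => n.
by apply: eq_integral => w _; rewrite /rademacher_sum /rest big_filter.
Qed.

Lemma probability_sign_split i (E : set T) : measurable E ->
  (P E = P (X i @^-1` [set 1%R] `&` E) + P (X i @^-1` [set (- 1)%R] `&` E))%E.
Proof.
move=> mE; have mX r : measurable (X i @^-1` [set r] `&` E).
  exact: measurableI.
have := ge0_integral_sign_split X_rademacher i mE (f := cst 1%E).
rewrite !integral_cst// !mul1e; apply => //.
Qed.

(** The limit argument bounds the parts of an event on [X k = s] and on [X k = - s] alike, and these
    parts exhaust its probability. *)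
Lemma rest_half k s (B : set R) : s = 1 \/ s = -1 -> measurable B ->
  (P (X k @^-1` [set s] `&` G k @^-1` B) = (2^-1)%:E * P (G k @^-1` B))%E.
Proof.
move=> s1; have mX r : measurable (X k @^-1` [set r]).
  by rewrite -[X in measurable X]setTI; exact: measurable_funP.
have le t : t = 1 \/ t = -1 ->
    forall x, (P (X k @^-1` [set t] `&` G k @^-1` `]-oo, x]) <= (2^-1)%:E * cdf (G k) x)%E.
  move=> t1; apply: (half_of_L1_limit _ _ (cvg_rest_L1 k)) => //.
    by move=> n; exact: measurable_rademacher_sum.
  move=> n B' mB'; apply: rademacher_sum_half => //=.
  by rewrite rest_uniq andbT mem_filter eqxx.
apply: (half_of_cdf (mX s) (mX (- s))).
- by case: s1 => ->; case: (X_rademacher k).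
- move=> E mE; rewrite (probability_sign_split k mE).
  by case: s1 => ->; rewrite ?opprK// addeC.
- exact: le.
- by apply: le; case: s1 => ->; rewrite ?opprK; [right|left].
Qed.

(** From [|S| <= (1 + S^2) / 2] and a second moment of at most 1. *)
Lemma integral_rest_sum_abs_le1 k n :
  (\int[P]_w `|(rademacher_sum X a (rest k n) w)%:E| <= 1)%E.
Proof.
set S := rademacher_sum X a (rest k n).
have mS : measurable_fun setT S by exact: measurable_rademacher_sum.
apply: (@le_trans _ _ (\int[P]_w (2^-1%:E * (1 + (S w ^+ 2)%:E)))%E).
  apply: ge0_le_integral => //.
  - by apply/measurable_EFinP; exact: measurableT_comp.
  - apply/measurable_EFinP; apply: measurable_funM => //.
    by apply: measurable_funD => //; exact: measurable_funX.
  - move=> w _; rewrite lee_fin.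
    have := sqr_ge0 (`|S w| - 1); rewrite sqrrB1 real_normK ?num_real//.
    by rewrite -mulr_natr; lra.
have mS2 : measurable_fun setT (fun w => (S w ^+ 2)%:E).
  by apply/measurable_EFinP; exact: measurable_funX.
rewrite ge0_integralZl//; last 2 first.
- by apply: emeasurable_funD.
- by move=> w _; rewrite adde_ge0// lee_fin sqr_ge0.
rewrite ge0_integralD//; last by move=> w _; rewrite lee_fin sqr_ge0.
rewrite integral_cst// mul1e [X in (X + _)%E](@probability_setT _ _ _ P).
rewrite integral_rademacher_sum_sqr// -EFinD -EFinM lee_fin.
have : \sum_(i <- rest k n) a i ^+ 2 <= 1.
  apply: le_trans (sum_sqr_le1 n); rewrite big_filter.
  rewrite [leRHS](bigID [pred i | i != k])/= lerDl.
  by apply: sumr_ge0 => i _; exact: sqr_ge0.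
by lra.
Qed.

Lemma integral_rest_abs_le1 k : (\int[P]_w `|(G k w)%:E| <= 1)%E.
Proof.
apply/lee_addgt0Pr => e e0.
have e0' : (0 < e%:E :> \bar R)%E by rewrite lte_fin.
have : (\forall n \near \oo,
    \int[P]_w `|(rademacher_sum X a (rest k n) w - G k w)%:E| < e%:E)%E.
  exact: cvg_rest_L1 (open_ereal_lt' e0').
move=> [n _ /(_ n (leqnn n))] /= lt.
have := integral_rest_sum_abs_le1 k n.
set S := rademacher_sum X a (rest k n) in lt *.
have mS : measurable_fun setT S by exact: measurable_rademacher_sum.
move=> S1; apply: le_trans (leeD S1 (ltW lt)).
rewrite -ge0_integralD//; last 2 first.
- by apply/measurable_EFinP; exact: measurableT_comp.
- by apply/measurable_EFinP; apply: measurableT_comp => //; exact: measurable_funB.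
apply: ge0_le_integral => //.
- by apply/measurable_EFinP; exact: measurableT_comp.
- apply: emeasurable_funD.
    by apply/measurable_EFinP; exact: measurableT_comp.
  by apply/measurable_EFinP; apply: measurableT_comp => //; exact: measurable_funB.
- move=> w _; rewrite /= lee_fin.
  rewrite -[X in `|X| <= _](subKr (S w)).
  exact: ler_normB.
Qed.

Lemma integrable_rest k : P.-integrable setT (EFin \o G k).
Proof.
apply/integrableP; split; first exact/measurable_EFinP.
exact: le_lt_trans (integral_rest_abs_le1 k) (ltry _).
Qed.

(** For [n > k] the partial sums of [F] and [G k] differ by exactly [a k * X k], so the L1 norm of
    the defect is at most the sum of two errors that tend to 0. Equality holds only almost
    everywhere, since [F] and [G k] are versions of their series. *)
Lemma series_decomposition k : {ae P, forall w, F w = G k w + a k * X k w}.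
Proof.
pose D w := F w - (G k w + a k * X k w).
have mD : measurable_fun setT D.
  by apply: measurable_funB => //; exact: measurable_funD.
suff : (\int[P]_w `|(D w)%:E| = 0)%E.
  move/(ae_eq_integral_abs P measurableT (proj2 (measurable_EFinP _ _) mD)).
  by apply: filterS => w /(_ I) [] /eqP; rewrite subr_eq0 => /eqP.
apply/eqP; rewrite eq_le integral_ge0// andbT.
have := cvgeD _ cvg_series_L1 (cvg_rest_L1 k).
rewrite adde0 => /(_ _ isT) c0.
rewrite -(cvg_lim _ c0)//; apply: lime_ge; first by apply/cvg_ex; exists 0%E.
near=> n; have kn : (k < n)%N by near: n; exact: nbhs_infty_gt.
have mS J : measurable_fun setT (rademacher_sum X a J).
  exact: measurable_rademacher_sum.
have m1 : measurable_fun setT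
    (fun w => `|(rademacher_sum X a (index_iota 0 n) w - F w)%:E|%E).
  by apply/measurable_EFinP; apply: measurableT_comp => //; exact: measurable_funB.
have m2 : measurable_fun setT
    (fun w => `|(rademacher_sum X a (rest k n) w - G k w)%:E|%E).
  by apply/measurable_EFinP; apply: measurableT_comp => //; exact: measurable_funB.
rewrite -ge0_integralD//; apply: ge0_le_integral => //.
- by apply/measurable_EFinP; exact: measurableT_comp.
- exact: emeasurable_funD.
- move=> w _; rewrite /= lee_fin.
  have -> : rademacher_sum X a (index_iota 0 n) w =
      rademacher_sum X a (rest k n) w + a k * X k w.
    rewrite /rademacher_sum /rest big_filter addrC.
    by rewrite (bigD1_seq k) ?mem_index_iota ?iota_uniq.
  rewrite /D; set s := rademacher_sum _ _ _ _; set t := a k * X k w.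
  rewrite (_ : _ - _ = (s - G k w) - (s + t - F w)); last by ring.
  by rewrite addrC ler_normB.
Unshelve. all: by end_near. Qed.

Let measurable_sign i r : measurable (X i @^-1` [set r]).
Proof. by rewrite -[X in measurable X]setTI; exact: measurable_funP. Qed.

Lemma Rintegral_sign_split i (h : T -> R) : P.-integrable setT (EFin \o h) ->
  \int[P]_w h w = \int[P]_(w in X i @^-1` [set 1]) h w +
                  \int[P]_(w in X i @^-1` [set (- 1)]) h w.
Proof.
move=> ih; pose U := X i @^-1` [set 1] `|` X i @^-1` [set (- 1)].
have mU : measurable U by exact: measurableU.
have PN : P (~` U) = 0%E.
  rewrite (probability_sign_split i (measurableC mU)).
  have -> : X i @^-1` [set 1] `&` ~` U = set0.
    by apply/seteqP; split => // w [w1 []]; left.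
  have -> : X i @^-1` [set (- 1)] `&` ~` U = set0.
    by apply/seteqP; split => // w [w1 []]; right.
  by rewrite measure0 adde0.
rewrite -Rintegral_setU//.
- congr fine; rewrite (negligible_integral (measurableC mU))//.
  by rewrite setTD setCK.
- exact: integrableS ih.
- by apply/disj_setPS => w [/= -> ?]; clear PN; lra.
Qed.

Lemma integrable_sign i : P.-integrable setT (EFin \o X i).
Proof.
apply/integrableP; split; first exact/measurable_EFinP.
rewrite (ge0_integral_sign_split X_rademacher i)//; last first.
  by apply/measurable_EFinP; exact: measurableT_comp.
rewrite !setIT lte_add_pinfty//.
- rewrite (eq_integral (cst 1%E)) => [|w].
    rewrite integral_cst// mul1e.
    by rewrite (le_lt_trans (probability_le1 _ _))// ltry.
  by rewrite inE /= => ->; rewrite normr1.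
- rewrite (eq_integral (cst 1%E)) => [|w].
    rewrite integral_cst// mul1e.
    by rewrite (le_lt_trans (probability_le1 _ _))// ltry.
  by rewrite inE /= => ->; rewrite normrN1.
Qed.

(** * Averaging a bounded function of the series over one sign *)

Section test_function.
Context (f : R -> R) (M : R).
Context (mf : measurable_fun setT f) (fM : forall y, `|f y| <= M).

Let integrable_comp (Y : T -> R) : measurable_fun setT Y ->
  P.-integrable setT (EFin \o (f \o Y)).
Proof.
move=> mY; apply: (@bounded_integrable _ _ _ _ (f \o Y) M) => [|w].
  exact: measurableT_comp.
exact: fM.
Qed.

Lemma integrable_mul_test (h Y : T -> R) : measurable_fun setT Y ->
  P.-integrable setT (EFin \o h) ->
  P.-integrable setT (EFin \o (fun w => h w * f (Y w))).
Proof.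
move=> mY ih; apply: (integrableMl measurableT ih).
  by exact: measurableT_comp.
exists M; split; first exact: num_real.
by move=> M' MM' w _ /=; rewrite (le_trans (fM _))// ltW.
Qed.

(** On this event [F] is almost surely [G k + s * a k], a function of [G k] alone, so
    [Rintegral_half] applies to the translate of [f]. *)
Lemma Rintegral_test_sign k (s : R) : s = 1 \/ s = -1 ->
  \int[P]_(w in X k @^-1` [set s]) f (F w) =
  2^-1 * \int[P]_w f (G k w + s * a k).
Proof.
move=> s1; have mfs : measurable_fun setT (fun y : R => f (y + s * a k)).
  by apply: measurableT_comp => //; exact: measurable_funD.
have PA : P (X k @^-1` [set s]) = (2^-1)%:E.
  by case: s1 => ->; case: (X_rademacher k).
rewrite -(Rintegral_half _ PA (fun B => @rest_half k s B s1) mfs (M := M))//.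
have m1 : measurable_fun setT (EFin \o (f \o F)).
  by apply/measurable_EFinP; exact: measurableT_comp.
have m2 : measurable_fun setT (EFin \o ((fun y => f (y + s * a k)) \o G k)).
  by apply/measurable_EFinP; exact: measurableT_comp.
congr fine; apply: ae_eq_integral => //.
- exact: measurable_funTS m1.
- exact: measurable_funTS m2.
- apply: filterS (series_decomposition k) => w -> /= Xw.
  by rewrite mulrC Xw.
Qed.

Lemma Rintegral_test k :
  \int[P]_w f (F w) =
  2^-1 * \int[P]_w f (G k w + a k) + 2^-1 * \int[P]_w f (G k w - a k).
Proof.
rewrite (Rintegral_sign_split k); last exact: integrable_comp.
rewrite !Rintegral_test_sign; [|by right|by left].
congr (_ * _ + _ * _); apply: eq_Rintegral => w _; first by rewrite mul1r.
by rewrite mulN1r.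
Qed.

Lemma Rintegral_sign_test k :
  \int[P]_w (X k w * f (F w)) =
  2^-1 * \int[P]_w f (G k w + a k) - 2^-1 * \int[P]_w f (G k w - a k).
Proof.
rewrite (Rintegral_sign_split k); last first.
  by apply: integrable_mul_test => //; exact: integrable_sign.
have iF A : measurable A -> P.-integrable A (EFin \o (fun w => f (F w))).
  have iFT : P.-integrable setT (EFin \o (f \o F)) by exact: integrable_comp.
  by move=> mA; exact: integrableS iFT.
rewrite (@eq_Rintegral _ _ _ P _ (fun w => f (F w))); last first.
  by move=> w; rewrite inE /= => ->; rewrite mul1r.
rewrite [X in _ + X](@eq_Rintegral _ _ _ P _ (fun w => -1 * f (F w))); last first.
  by move=> w; rewrite inE /= => ->.
rewrite RintegralZl//; last exact: iF.
rewrite !Rintegral_test_sign; [|by right|by left].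
rewrite mulN1r; congr (_ * _ - _ * _); apply: eq_Rintegral => w _.
  by rewrite mul1r.
by rewrite mulN1r.
Qed.

End test_function.

(** * The Stein error of a single coefficient *)

Let window (x : R) k : set T := [set w | x - `|a k| < G k w <= x + `|a k|].

Let measurable_window (x : R) k : measurable (window x k).
Proof.
rewrite (_ : window x k = G k @^-1` `](x - `|a k|), (x + `|a k|)]).
  by rewrite -[X in measurable X]setTI; exact: measurable_funP.
by apply/seteqP; split => w /=; rewrite in_itv.
Qed.

Let integrable_normr_rest k : P.-integrable setT (EFin \o (fun w => `|G k w|)).
Proof. by apply: integrable_norm; exact: integrable_rest. Qed.

Let Rintegral_normr_rest_le1 k : \int[P]_w `|G k w| <= 1.
Proof.
rewrite -lee_fin /Rintegral fineK; first exact: integral_rest_abs_le1.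
by apply: integrable_fin_num => //; exact: integrable_normr_rest.
Qed.

Let Rintegral_indic (A : set T) : measurable A -> \int[P]_w \1_A w = fine (P A).
Proof. by move=> mA; rewrite /Rintegral integral_indic// setIT. Qed.

Let integrable_indicP (A : set T) : measurable A ->
  P.-integrable setT (EFin \o (\1_A : T -> R)).
Proof.
move=> mA; apply: (@bounded_integrable _ _ _ _ _ 1) => [|w].
  exact: measurable_indic.
by rewrite indicE; case: (w \in A); rewrite ?normr1 ?normr0.
Qed.

Let integrable_cstP (r : R) : P.-integrable setT (EFin \o (fun=> r)).
Proof. exact: finite_measure_integrable_cst. Qed.

Let Rintegral_cstP (r : R) : \int[P]_w r = r.
Proof.
rewrite Rintegral_cst// [fine _](congr1 fine (@probability_setT _ _ _ P)).
by rewrite mulr1.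
Qed.

Let integrableDP (f g : T -> R) : P.-integrable setT (EFin \o f) ->
  P.-integrable setT (EFin \o g) ->
  P.-integrable setT (EFin \o (fun w => f w + g w)).
Proof. by move=> fi gi; have := integrableD measurableT fi gi. Qed.

Let integrableBP (f g : T -> R) : P.-integrable setT (EFin \o f) ->
  P.-integrable setT (EFin \o g) ->
  P.-integrable setT (EFin \o (fun w => f w - g w)).
Proof. by move=> fi gi; have := integrableB measurableT fi gi. Qed.

Let integrableZP (r : R) (f : T -> R) : P.-integrable setT (EFin \o f) ->
  P.-integrable setT (EFin \o (fun w => r * f w)).
Proof. by move=> fi; have := integrableZl measurableT r fi. Qed.

Let stein_bound (x y : R) : `|stein x y| <= 2.
Proof. by rewrite ger0_norm ?stein_ge0// stein_le2. Qed.

Let integrable_stein (x : R) (Y : T -> R) : measurable_fun setT Y ->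
  P.-integrable setT (EFin \o (fun w => stein x (Y w))).
Proof.
move=> mY; apply: (@bounded_integrable _ _ _ _ _ 2) => [|w].
  by apply: measurableT_comp => //; exact: measurable_stein.
exact: stein_bound.
Qed.

Let integrable_dstein (x : R) (Y : T -> R) : measurable_fun setT Y ->
  P.-integrable setT (EFin \o (fun w => dstein x (Y w))).
Proof.
move=> mY; apply: (@bounded_integrable _ _ _ _ _ 2) => [|w].
  by apply: measurableT_comp => //; exact: measurable_dstein.
exact: normr_dstein_le2.
Qed.

Lemma stein_term_le (x : R) k :
  `|a k ^+ 2 * \int[P]_w dstein x (F w) - a k * \int[P]_w (X k w * stein x (F w))|
    <= 2 * `|a k| ^+ 3 + a k ^+ 2 * fine (P (window x k)).
Proof.
have mGp : measurable_fun setT (fun w => G k w + a k) by exact: measurable_funD.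
have mGm : measurable_fun setT (fun w => G k w - a k) by exact: measurable_funB.
have iup := integrable_dstein x mGp; have ium := integrable_dstein x mGm.
have igp := integrable_stein x mGp; have igm := integrable_stein x mGm.
rewrite (Rintegral_test (@measurable_dstein _ x) (@normr_dstein_le2 _ x) k).
rewrite (Rintegral_sign_test (@measurable_stein _ x) (stein_bound x) k).
pose h w := a k ^+ 2 * (dstein x (G k w + a k) + dstein x (G k w - a k)) -
  a k * (stein x (G k w + a k) - stein x (G k w - a k)).
have ih : P.-integrable setT (EFin \o h).
  apply: integrableBP; apply: integrableZP.
    exact: integrableDP.
  exact: integrableBP.
have hE : \int[P]_w h w =
    a k ^+ 2 * (\int[P]_w dstein x (G k w + a k) + \int[P]_w dstein x (G k w - a k)) -
    a k * (\int[P]_w stein x (G k w + a k) - \int[P]_w stein x (G k w - a k)).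
  have iu := integrableDP iup ium; have ig := integrableBP igp igm.
  rewrite /h RintegralB//; [|exact: integrableZP iu|exact: integrableZP ig].
  rewrite (RintegralZl _ measurableT iu) (RintegralZl _ measurableT ig).
  by congr (_ * _ - _ * _); [exact: RintegralD|exact: RintegralB].
rewrite [X in `|X|](_ : _ = 2^-1 * \int[P]_w h w); last by rewrite hE; ring.
rewrite normrM ger0_norm ?invr_ge0//.
pose b := `|a k|.
have b0 : 0 <= b by exact: normr_ge0.
have hb w : `|h w| <= b ^+ 3 * `|G k w| + b ^+ 3 * (b + 2) + b ^+ 2 * \1_(window x k) w.
  (* [h] is even in [a k], so [a k] may be replaced by the radius [b], as [stein_difference_le]
     requires. *)
  have -> : h w = b * (b * (dstein x (G k w + b) + dstein x (G k w - b)) -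
                       (stein x (G k w + b) - stein x (G k w - b))).
    rewrite /h /b; have [a0|a0] := ger0P (a k); first by ring.
    by rewrite opprK; ring.
  rewrite normrM (ger0_norm b0).
  apply: (le_trans (ler_wpM2l b0 (stein_difference_le x (G k w) b0))).
  rewrite indicE mem_setE /window/= -/b; set q := (X in _ * X%:R); set i := q%:R.
  by rewrite le_eqVlt; apply/orP; left; apply/eqP; ring.
have i1 : P.-integrable setT (EFin \o (fun w => b ^+ 3 * `|G k w|)).
  exact: integrableZP.
have i2 := integrable_cstP (b ^+ 3 * (b + 2)).
have i3 : P.-integrable setT (EFin \o (fun w => b ^+ 2 * \1_(window x k) w)).
  by apply: integrableZP; exact: integrable_indicP.
have : \int[P]_w `|h w| <= b ^+ 3 + b ^+ 3 * (b + 2) + b ^+ 2 * fine (P (window x k)).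
  apply: (@le_trans _ _ (\int[P]_w (b ^+ 3 * `|G k w| + b ^+ 3 * (b + 2) +
                                    b ^+ 2 * \1_(window x k) w))).
    apply: le_Rintegral => //; first exact: integrable_norm.
    by apply: integrableDP => //; exact: integrableDP.
  rewrite RintegralD//; last exact: integrableDP.
  rewrite RintegralD// !RintegralZl//; last exact: integrable_indicP.
  rewrite Rintegral_cstP Rintegral_indic// !lerD2r.
  by rewrite ler_piMr// exprn_ge0.
have : `|\int[P]_w h w| <= \int[P]_w `|h w| by exact: le_normr_Rintegral.
(* The constant [2] of the theorem: [(E `|G k| + `|a k| + 2) / 2 <= 2]. *)
have b1 : b <= 1 by exact: normr_coef_le1.
have p0 : 0 <= fine (P (window x k)) by exact: fine_ge0.
have -> : a k ^+ 2 = b ^+ 2 by rewrite /b real_normK ?num_real.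
have b3 : 0 <= b ^+ 3 by exact: exprn_ge0.
have bb : b ^+ 3 * b <= b ^+ 3 by rewrite ler_piMr.
have bp : 0 <= b ^+ 2 * fine (P (window x k)) by rewrite mulr_ge0// exprn_ge0.
rewrite -/b; lra.
Qed.

(** The truncated weight on the left tends to 1, which recovers the full integral of [dstein] in the
    limit. *)
Lemma stein_sum_le (x : R) n :
  `|(\sum_(0 <= k < n) a k ^+ 2) * \int[P]_w dstein x (F w) -
    \sum_(0 <= k < n) a k * \int[P]_w (X k w * stein x (F w))|
  <= \sum_(0 <= k < n) (2 * `|a k| ^+ 3 + a k ^+ 2 * fine (P (window x k))).
Proof.
rewrite mulr_suml -sumrB; apply: le_trans (ler_norm_sum _ _ _) _.
by apply: ler_sum => k _; exact: stein_term_le.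
Qed.

(** * Passage from partial sums to the series *)

Lemma integrable_rademacher_sum J :
  P.-integrable setT (EFin \o rademacher_sum X a J).
Proof.
elim: J => [|i J IH].
  rewrite (_ : rademacher_sum X a [::] = (fun=> 0)); first exact: integrable_cstP.
  by apply/funext => w; rewrite /rademacher_sum big_nil.
rewrite (_ : rademacher_sum X a (i :: J) =
             (fun w => a i * X i w + rademacher_sum X a J w)).
  by apply: integrableDP => //; apply: integrableZP; exact: integrable_sign.
by apply/funext => w; rewrite /rademacher_sum big_cons.
Qed.

Lemma Rintegral_rademacher_sum_stein (x : R) J :
  \int[P]_w (rademacher_sum X a J w * stein x (F w)) =
  \sum_(k <- J) a k * \int[P]_w (X k w * stein x (F w)).
Proof.
elim: J => [|i J IH].
  rewrite big_nil -[RHS](Rintegral_cstP 0); apply: eq_Rintegral => w _.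
  by rewrite /rademacher_sum big_nil mul0r.
have mg := @measurable_stein _ x.
have iX : P.-integrable setT (EFin \o (fun w => X i w * stein x (F w))).
  by apply: (integrable_mul_test mg (stein_bound x)) => //; exact: integrable_sign.
rewrite big_cons -IH -RintegralZl// -RintegralD//; last 2 first.
- exact: integrableZP.
- apply: (integrable_mul_test mg (stein_bound x)) => //.
  exact: integrable_rademacher_sum.
apply: eq_Rintegral => w _; rewrite /rademacher_sum big_cons; ring.
Qed.

Let integrable_series_stein (x : R) :
  P.-integrable setT (EFin \o (fun w => F w * stein x (F w))).
Proof.
apply: (@bounded_integrable _ _ _ _ _ 1) => [|w].
  apply: measurable_funM => //; apply: measurableT_comp => //.
  exact: measurable_stein.
exact: normr_mul_stein_le1.
Qed.

(** A single partial sum at L1 distance less than 1 suffices: [F = S - (S - F)]. *)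
Lemma integrable_series : P.-integrable setT (EFin \o F).
Proof.
have : (\forall n \near \oo,
    \int[P]_w `|(rademacher_sum X a (index_iota 0 n) w - F w)%:E| < 1%:E)%E.
  by apply: cvg_series_L1 (open_ereal_lt' _); rewrite lte_fin.
move=> [n _ /(_ n (leqnn n))] /=; set S := rademacher_sum X a _ => lt1.
have iS : P.-integrable setT (EFin \o S) by exact: integrable_rademacher_sum.
have iSF : P.-integrable setT (EFin \o (fun w => S w - F w)).
  apply/integrableP; split; last by rewrite (lt_trans lt1)// ltry.
  apply/measurable_EFinP; apply: measurable_funB => //.
  exact: measurable_rademacher_sum.
have := integrableBP iS iSF; apply: eq_integrable => // w _ /=.
by rewrite subKr.
Qed.

Lemma cvg_Rintegral_stein (x : R) :
  \sum_(0 <= k < n) a k * \int[P]_w (X k w * stein x (F w)) @[n --> \oo] -->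
  \int[P]_w (F w * stein x (F w)).
Proof.
have c0 : fine (\int[P]_w
    `|(rademacher_sum X a (index_iota 0 n) w - F w)%:E|)%E @[n --> \oo] --> (0 : R).
  exact: fine_cvg cvg_series_L1.
apply/cvgrPdist_le => e e0.
(* The factor [stein x (F w)] is at most 2, so L1 errors of e/2 give e. *)
have e2 : 0 < e / 2 by rewrite divr_gt0.
move: c0 => /cvgrPdist_le /(_ _ e2); apply: filterS => n.
rewrite sub0r normrN -Rintegral_rademacher_sum_stein.
set S := rademacher_sum X a _ => le.
have iS : P.-integrable setT (EFin \o S) by exact: integrable_rademacher_sum.
have iF := integrable_series.
have mg := @measurable_stein _ x.
have iSg := integrable_mul_test mg (stein_bound x) (measurable_funPT F) iS.
have iSF := integrableBP iS iF.
have iSFg := integrable_mul_test mg (stein_bound x) (measurable_funPT F) iSF.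
rewrite distrC -RintegralB//.
rewrite (@eq_Rintegral _ _ _ P _ (fun w => (S w - F w) * stein x (F w))); last first.
  by move=> w _; ring.
apply: le_trans (le_normr_Rintegral measurableT iSFg) _.
apply: (@le_trans _ _ (\int[P]_w (2 * `|S w - F w|))).
  apply: le_Rintegral => //.
  - exact: integrable_norm.
  - by apply: integrableZP; exact: integrable_norm.
  - by move=> w _; rewrite normrM mulrC ler_wpM2r.
rewrite RintegralZl//; last exact: integrable_norm.
move: le; rewrite /= ger0_norm; last by rewrite fine_ge0// integral_ge0.
by rewrite /Rintegral; lra.
Qed.

(** The value of [dstein] at the kink makes Stein's equation hold at every point, so its expectation
    is exact even if [F] has an atom at [x]. *)
Lemma cdf_series_stein (x : R) :
  fine (cdf F x) - gcdf x =
  \int[P]_w dstein x (F w) - \int[P]_w (F w * stein x (F w)).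
Proof.
rewrite -RintegralB//; last exact: integrable_dstein.
have mA : measurable (F @^-1` `]-oo, x]).
  by rewrite -[X in measurable X]setTI; exact: measurable_funP.
rewrite (@eq_Rintegral _ _ _ P _ (fun w => \1_(F @^-1` `]-oo, x]) w - gcdf x)); last first.
  move=> w _; rewrite /dstein indicE mem_setE /= ?in_itv/=; ring.
rewrite RintegralB//; last exact: integrable_indicP.
by rewrite Rintegral_cstP Rintegral_indic.
Qed.

(** The limit of [stein_sum_le]: the left-hand sides converge, and the partial sums on the right are
    bounded by the full series because their terms are nonnegative. *)
Lemma cdf_series_gcdf_le (x : R) :
  (`|(fine (cdf F x) - gcdf x)%:E| <=
   2%:E * \sum_(0 <= i <oo) (`|a i| ^+ 3)%:E +
   \sum_(0 <= k <oo) ((a k) ^+ 2)%:E * P (window x k))%E.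
Proof.
pose u n := (\sum_(0 <= k < n) a k ^+ 2) * \int[P]_w dstein x (F w) -
  \sum_(0 <= k < n) a k * \int[P]_w (X k w * stein x (F w)).
have c : `|u n| @[n --> \oo] --> `|fine (cdf F x) - gcdf x|.
  rewrite cdf_series_stein -[X in X - _]mul1r; apply: cvg_norm.
  apply: cvgB; last exact: cvg_Rintegral_stein.
  by apply: cvgMl; exact: cvg_sum_sqr.
have cE : `|u n|%:E @[n --> \oo] --> `|fine (cdf F x) - gcdf x|%:E.
  by apply: cvg_EFin; [exact: nearW|exact: c].
rewrite abse_EFin -(cvg_lim _ cE)//.
apply: lime_le; first by apply/cvg_ex; eexists; exact: cE.
apply: nearW => n; apply: (@le_trans _ _ (\sum_(0 <= k < n)
    (2 * `|a k| ^+ 3 + a k ^+ 2 * fine (P (window x k))))%:E).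
  by rewrite lee_fin; exact: stein_sum_le.
rewrite big_split/= -mulr_sumr EFinD EFinM -!sumEFin; apply: leeD.
  rewrite lee_pmul2l// ?lte_fin//; apply: nneseries_lim_ge => i _ _.
  by rewrite lee_fin exprn_ge0.
under eq_bigr do rewrite EFinM fineK ?fin_num_measure//.
apply: nneseries_lim_ge => i _ _.
by rewrite mule_ge0// lee_fin sqr_ge0.
Qed.

End rademacher_series.

Local Open Scope ereal_scope.

Theorem theorem4p1 (R : realType)
    (d : measure_display) (T : measurableType d) (P : probability T R)
    (d' : measure_display) (T' : measurableType d') (Q : probability T' R)
    (X : nat -> {RV P >-> R}) (a : nat -> R)
    (F : {RV P >-> R}) (G : nat -> {RV P >-> R}) (N : {RV Q >-> R})
    (X_indep : independent_RVs X)
    (X_rademacher : forall i, rademacher (X i))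
    (a_norm1 : \sum_(0 <= i <oo) ((a i) ^+ 2)%:E = 1)
    (F_sum : L2_sum xpredT (fun i w => (a i * X i w)%R) F)
    (G_sum : forall k : nat,
       L2_sum [pred i : nat | i != k] (fun i w => (a i * X i w)%R) (G k))
    (N_gaussian : standard_gaussian N) :
  kolmogorov_distance F N <=
    2%:E * \sum_(0 <= i <oo) (`|a i| ^+ 3)%:E +
    ereal_sup (range (fun x : R =>
      \sum_(0 <= k <oo) ((a k) ^+ 2)%:E *
        P [set w | (x - `|a k| < G k w <= x + `|a k|)%R])).
Proof.
apply: ge_ereal_sup => _ [x _ <-].
have -> : cdf N x = (gcdf x)%:E.
  by rewrite -normal_prob_gcdf; exact: N_gaussian.
have -> : cdf F x = (fine (cdf F x))%:E by rewrite fineK// fin_num_measure.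
rewrite -EFinB.
apply: le_trans
  (cdf_series_gcdf_le X_indep X_rademacher a_norm1 F_sum G_sum x) _.
by rewrite leeD2l// ereal_sup_ubound//; exists x.
Qed.
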